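(* Let $T_r$ be the NURBS numerical solution of $\mathcal{D}T=f$ in $\Omega$, $\mathcal{G}T=g$ on $\partial\Omega$, produced by the isogeometric least-squares collocation (IGA-L) method, defined on a knot grid $\mathcal{T}^h$ with knot grid size $h$. Let $R(\boldsymbol{\eta})=(\mathcal{D}T(\boldsymbol{\eta})-\mathcal{D}T_r(\boldsymbol{\eta}))^2$ for $\boldsymbol{\eta}\in\Omega_0$, and let $e_h=\sum_kR(\boldsymbol{\vartheta}_k)$ be the least-squares fitting error, where $\boldsymbol{\vartheta}_k\in\Omega_0$ are the collocation points. Suppose that (1) each knot interval of the NURBS function $T_r$ defined on $\mathcal{T}^h$ contains at least one collocation point; (2) the degree of each variable in $T_r$ is larger than the maximum order of the partial derivatives with respect to that variable appearing in $\mathcal{D}$; (3) the least-squares fitting error $e_h$ is bounded; (4) $R\in C^1(\Omega_0)$. Then the IGA-L method is consistent, i.e. $\|\mathcal{D}T-\mathcal{D}T_r\|_2^2\to0$ as $h\to0$.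
   Context: Boundary value problem: $\mathcal{D}T=f$ in $\Omega\subset\mathbb{R}^d$, $\mathcal{G}T=g$ on $\partial\Omega$, with $d\in\{1,2,3\}$; $\mathcal{D}:V\to W$ is a differential operator between Hilbert spaces with maximal derivative order $d_1\ge1$, $f:\Omega\to\mathbb{R}$ and $g:\partial\Omega\to\mathbb{R}$ are given, and the analytical solution satisfies $T\in C^{d_2}(\Omega)$, $d_2>d_1$. The domain $\Omega$ is parametrized by a NURBS mapping $\mathbf{F}:\Omega_0\to\Omega$, where $\Omega_0\subset\mathbb{R}^d$ is the parametric domain; functions on $\Omega$ are regarded as functions of the parameter $\boldsymbol{\eta}\in\Omega_0$, and $\|\cdot\|_2$ is the $L^2$ norm over $\Omega_0$. Knots: $T_r$ is a NURBS function (tensor-product for $d=2,3$) defined, in each parametric direction, on a knot sequence of the form $\{\underbrace{u_0,\dots,u_0}_{l_u+1},u_1,\dots,u_{n_u-1},\underbrace{u_{n_u},\dots,u_{n_u}}_{l_u+1}\}$ with $l_u$ the degree in that direction (similarly for $v$ and $w$). $\Omega_0$ is the product of the intervals $[u_0,u_{n_u}]$, $[v_0,v_{n_v}]$, $[w_0,w_{n_w}]$ (as many as the dimension). The knot intervals are the cells $[u_i,u_{i+1}]$, $[u_i,u_{i+1}]\times[v_j,v_{j+1}]$, or $[u_i,u_{i+1}]\times[v_j,v_{j+1}]\times[w_k,w_{k+1}]$, respectively; they form the knot grid $\mathcal{T}^h$, and the knot grid size $h$ is the maximum (Euclidean) diameter of these cells. IGA-L method: with $n$ the number of unknown coefficients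 of $T_r$, choose $m_1$ collocation points in the interior and $m_2$ on the boundary of the parametric domain, $m_1+m_2>n$; impose $\mathcal{D}T_r=f$ at the interior ones and $\mathcal{G}T_r=g$ at the boundary ones, obtaining a linear system $AX=b$ in the vector $X$ of coefficients, and determine $X$ by $\min_X\|AX-b\|^2$. Standing assumption: $A$ has full rank.
   Formalization: Condition (4) is strengthened: besides R being in C^1(Ω0) for each grid, its first partial derivatives are assumed bounded by a constant independent of h; with C^1 membership for each h separately the claim is false. *)

(* Defs.v *)
From HB Require Import structures.
From mathcomp Require Import all_boot all_order all_algebra.
From mathcomp Require Import all_classical all_reals all_analysis.
Set Implicit Arguments.
Unset Strict Implicit.
Unset Printing Implicit Defensive.
Import Order.TTheory GRing.Theory Num.Theory.
Import numFieldNormedType.Exports.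
Local Open Scope classical_set_scope.
Local Open Scope ring_scope.

Section Calculus.
Context (R : realType) (d : nat).
Implicit Types (S : set 'rV[R]_d) (f : 'rV[R]_d -> R) (x : 'rV[R]_d).

Definition bdry S : set 'rV[R]_d := S `\` S°.

(* The matrix norm of the library is the sup norm. *)
Definition enorm n (v : 'rV[R]_n) : R := Num.sqrt (\sum_i (v 0 i) ^+ 2).

Definition ediam S : R := sup [set enorm (p.1 - p.2) | p in S `*` S].

(* i-th partial derivative relative to S: the increment stays in S. At interior
   points of S this is the usual partial derivative, on the faces of a closed
   box the one-sided one. *)
Definition pderiv S (i : 'I_d) f x : R :=
  lim ((h^-1 * (f (x + h *: delta_mx 0 i) - f x))
    @[h --> within [set h : R | S (x + h *: delta_mx 0 i)] 0^']).

Definition mpderiv S (alpha : 'I_d -> nat) f : 'rV[R]_d -> R :=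
  foldr (fun i g => iter (alpha i) (pderiv S i) g) f (enum 'I_d).

(* Only the multi-indices with |alpha| <= k are used, see [diffop]. *)
Definition mindex (k : nat) := {ffun 'I_d -> 'I_k.+1}.

Definition mdeg k (alpha : mindex k) : nat := (\sum_i alpha i)%N.

Definition diffop S k (a : mindex k -> 'rV[R]_d -> R) f x : R :=
  \sum_(alpha | (mdeg alpha <= k)%N) a alpha x * mpderiv S (fun i => alpha i : nat) f x.

(* C^k(S) for a set S that may contain boundary points: the partial derivatives
   in the interior of S up to order k extend continuously to S. *)
Fixpoint Ck S k f : Prop :=
  {within S, continuous f} /\
  if k is k'.+1 then
    forall i : 'I_d, exists g : 'rV[R]_d -> R,
      (forall x, S° x -> is_derive x (delta_mx 0 i : 'rV[R]_d) f (g x))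
      /\ Ck S k' g
  else True.

(* A sequence in C^1(S) whose first derivatives are bounded independently of the
   index. Membership of each r n in C^1(S) alone would only give bounds that
   depend on n. *)
Definition C1_family S (r : nat -> 'rV[R]_d -> R) : Prop :=
  (forall n, Ck S 1 (r n)) /\
  exists M : R, forall n (i : 'I_d) x, S° x ->
    `|'D_(delta_mx 0 i : 'rV[R]_d) (r n) x| <= M.

Definition vec (s : seq R) : 'rV[R]_d := \row_(i < d) s`_i.

(* L^2(S) norm for Lebesgue measure on R^d; meant for 1 <= d <= 3 only. *)
Definition L2norm S f : \bar R :=
  let mu := @lebesgue_measure R in
  let u s := (\1_S (vec s) * f (vec s))%:E in
  match d with
  | 1 => 'N[mu]_2%:E[(fun t => u [:: t])]
  | 2 => 'N[mu \x mu]_2%:E[(fun p => u [:: p.1; p.2])]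
  | 3 => 'N[(mu \x mu) \x mu]_2%:E[(fun p => u [:: p.1.1; p.1.2; p.2])]
  | _ => 0
  end%E.

End Calculus.

Section Nurbs.
Context (R : realType).

(* Breakpoints u_0 < ... < u_n to the knot sequence with both end knots of
   multiplicity l + 1 (the subtraction is truncated). *)
Definition clamped (l n : nat) (u : nat -> R) (j : nat) : R :=
  u (minn (j - l) n).

(* Cox-de Boor recursion, with x / 0 = 0. The last nonempty knot interval is
   closed on the right at the end point e of the parameter interval. *)
Fixpoint bspline (xi : nat -> R) (e : R) (l j : nat) (t : R) : R :=
  if l is l'.+1 then
    (t - xi j) / (xi (j + l)%N - xi j) * bspline xi e l' j t
    + (xi (j + l).+1 - t) / (xi (j + l).+1 - xi j.+1)
        * bspline xi e l' j.+1 t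
  else ((xi j <= t < xi j.+1) || [&& t == e, xi j < t & t == xi j.+1])%:R.

(* Coefficients are indexed by tuples (j_i), j_i < nel i + deg i, one entry per
   parametric direction. *)
Record nurbs_space (d : nat) := NurbsSpace {
  deg : 'I_d -> nat;
  nel : 'I_d -> nat;
  brk : 'I_d -> nat -> R;
  wgt : {dffun forall i : 'I_d, 'I_(nel i + deg i)} -> R;
  nel_gt0 : forall i, (0 < nel i)%N;
  brk_lt : forall i j, (j < nel i)%N -> brk i j < brk i j.+1;
  wgt_gt0 : forall j, 0 < wgt j }.

Section Space.
Context (d : nat) (N : nurbs_space d).

Definition nidx : finType := {dffun forall i : 'I_d, 'I_(nel N i + deg N i)}.

Definition nunk : nat := #|nidx|.

Definition tensor_bspline (j : nidx) (eta : 'rV[R]_d) : R :=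
  \prod_i bspline (clamped (deg N i) (nel N i) (brk N i)) (brk N i (nel N i))
    (deg N i) (j i) (eta 0 i).

Definition nurbs_basis (j : nidx) (eta : 'rV[R]_d) : R :=
  @wgt d N j * tensor_bspline j eta
  / \sum_(k : nidx) @wgt d N k * tensor_bspline k eta.

Definition nurbs_fun (X : 'cV[R]_nunk) (eta : 'rV[R]_d) : R :=
  \sum_(j < nunk) nurbs_basis (enum_val j) eta * X j 0.

Definition nurbs_map (P : nidx -> 'rV[R]_d) (eta : 'rV[R]_d) : 'rV[R]_d :=
  \sum_(j : nidx) nurbs_basis j eta *: P j.

Definition nurbs_domain : set 'rV[R]_d :=
  [set eta | forall i, brk N i 0 <= eta 0 i <= brk N i (nel N i)].

Definition cell_idx : finType := {dffun forall i : 'I_d, 'I_(nel N i)}.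

Definition cell (q : cell_idx) : set 'rV[R]_d :=
  [set eta | forall i, brk N i (q i) <= eta 0 i <= brk N i (q i).+1].

Definition grid_size : R := \big[Num.max/0]_(q : cell_idx) ediam (cell q).

End Space.

(* F parametrizes Omega by Omega0 through NURBS, with inverse Finv. *)
Definition nurbs_param d (Omega0 Omega : set 'rV[R]_d)
    (F Finv : 'rV[R]_d -> 'rV[R]_d) : Prop :=
  [/\ exists (N : nurbs_space d) (P : nidx N -> 'rV[R]_d),
        nurbs_domain N = Omega0
        /\ (forall eta, Omega0 eta -> F eta = nurbs_map P eta),
      F @` Omega0 = Omega
    & forall eta, Omega0 eta -> Finv (F eta) = eta].

End Nurbs.

Section Operator.
Context (R : realType) (d : nat).
Variables (Omega0 Omega : set 'rV[R]_d) (F : 'rV[R]_d -> 'rV[R]_d).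

(* The operator with coefficients c has order exactly d1 on Omega. *)
Definition has_order d1 (c : mindex d d1 -> 'rV[R]_d -> R) : Prop :=
  exists alpha, mdeg alpha = d1 /\ exists2 x, Omega x & c alpha x != 0.

(* a is the expression, in the parametric variables, of the operator with
   coefficients c in the physical variables. *)
Definition param_expr d1 (c a : mindex d d1 -> 'rV[R]_d -> R) : Prop :=
  forall phi, Ck Omega d1 phi -> forall eta, Omega0° eta ->
    diffop Omega c phi (F eta) = diffop Omega0 a (phi \o F) eta.

(* Order bound, in the i-th parametric variable, for the derivatives that
   really appear in the operator. *)
Definition order_in_lt d1 (a : mindex d d1 -> 'rV[R]_d -> R) (i : 'I_d)
    (l : nat) : Prop :=
  forall alpha, (mdeg alpha <= d1)%N ->
    (exists2 eta, Omega0 eta & a alpha eta != 0) -> (alpha i < l)%N.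

End Operator.

Section Igal.
Context (R : realType) (d : nat).

Record discretization := Discretization {
  trial_space : nurbs_space R d;
  m1 : nat;
  m2 : nat;
  inner_pt : 'I_m1 -> 'rV[R]_d;
  bdry_pt : 'I_m2 -> 'rV[R]_d }.

Definition colloc (p : discretization) (k : 'I_(m1 p + m2 p)) : 'rV[R]_d :=
  match fintype.split k with inl i => inner_pt i | inr j => bdry_pt j end.

Definition sqnorm m (v : 'cV[R]_m) : R := \sum_k v k 0 ^+ 2.

Variables (DD GG : ('rV[R]_d -> R) -> 'rV[R]_d -> R) (ff gg : 'rV[R]_d -> R).

Definition igal_matrix (p : discretization) :
    'M[R]_(m1 p + m2 p, nunk (trial_space p)) :=
  col_mx (\matrix_(k, j) DD (nurbs_basis (enum_val j)) (inner_pt k))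
         (\matrix_(k, j) GG (nurbs_basis (enum_val j)) (bdry_pt k)).

Definition igal_rhs (p : discretization) : 'cV[R]_(m1 p + m2 p) :=
  col_mx (\col_k ff (inner_pt k)) (\col_k gg (bdry_pt k)).

(* All data are functions of the parameter: DD, GG are the domain and the
   boundary operator, ff, gg the right-hand sides. The sixth clause says that
   the boundary conditions are linear in the unknown coefficients. *)
Definition igal_solution (Omega0 : set 'rV[R]_d) (p : discretization)
    (X : 'cV[R]_(nunk (trial_space p))) : Prop :=
  [/\ nurbs_domain (trial_space p) = Omega0,
      forall k, Omega0° (@inner_pt p k),
      forall k, bdry Omega0 (@bdry_pt p k)
    & (nunk (trial_space p) < m1 p + m2 p)%N] /\
  [/\ \rank (igal_matrix p) = nunk (trial_space p),
      forall Y eta, bdry Omega0 eta ->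
        GG (nurbs_fun Y) eta
        = \sum_j GG (@nurbs_basis R d (trial_space p) (enum_val j)) eta * Y j 0
    & forall Y, sqnorm (igal_matrix p *m X - igal_rhs p)
             <= sqnorm (igal_matrix p *m Y - igal_rhs p)].

End Igal.

Definition sqres (R : realType) (d : nat)
    (DD : ('rV[R]_d -> R) -> 'rV[R]_d -> R) (T Tr : 'rV[R]_d -> R)
    (eta : 'rV[R]_d) : R :=
  (DD T eta - DD Tr eta) ^+ 2.

Definition fit_error (R : realType) (d : nat) (p : discretization R d)
    (r : 'rV[R]_d -> R) : R :=
  \sum_k r (@colloc R d p k).

(* Main.v *)
Require Import Defs.
From HB Require Import structures.
From mathcomp Require Import all_boot all_order all_algebra.
From mathcomp Require Import all_classical all_reals all_analysis.
From mathcomp Require Import ring lra zify.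

(** The squared residuals r_n = Rh n are nonnegative, their values at the
    collocation points sum to at most C, and their first partial derivatives are
    bounded by one constant M.  As the grid is refined, these facts force r_n to
    0 uniformly on the parametric box, which is more than convergence of
    the integrals.

    The derivative bound makes every r_n Lipschitz on the closed box, with one
    constant ([box_lipschitz]).  Suppose that r_n x > e for some x.  Then r_n
    stays above e/2 within a distance D of x that depends on e, M and the box only.  Fix K
    with K e/2 > C, and place K equally spaced points on an axis-parallel segment
    of length at most D/2 that starts at x and remains in the box.  Each lies in
    a knot cell, hence within h of a collocation point.  Once 2h is smaller than
    the spacing, and h smaller than D/2, these K collocation points are distinct
    and all see r_n >= e/2; so the fitting error exceeds C, a contradiction
    ([sampled_le]).  The threshold on h depends on e, M, C and the box, not on
    n, which is what makes the conclusion uniform.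

    The squared L2 norm is then at most e times the volume of the box
    ([L2norm_sqr_le]).  Arguing through the supremum, rather than summing
    (volume of the cell) * (value at a collocation point) over the cells, avoids
    additivity of the integral over the grid and the multiplicity of a
    collocation point lying in several cells. *)

Set Implicit Arguments.
Unset Strict Implicit.
Unset Printing Implicit Defensive.
Import Order.TTheory GRing.Theory Num.Theory.
Import numFieldNormedType.Exports.
Local Open Scope classical_set_scope.
Local Open Scope ring_scope.

(** * Lipschitz bounds on a box *)

Lemma itv_approx (R : realFieldType) (a b t e : R) : a < b -> a <= t <= b -> 0 < e ->
  exists s, a < s < b /\ `|t - s| < e.
Proof.
move=> ab tin e0; pose m := Num.min (e / 2) ((b - a) / 4).
have m0 : 0 < m by rewrite lt_min; lra.
have me : m <= e / 2 by rewrite ge_min lexx.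
have mb : m <= (b - a) / 4 by rewrite ge_min lexx orbT.
have [tm|tm] := leP t ((a + b) / 2).
  by exists (t + m); split; [|rewrite ltr_norml]; lra.
by exists (t - m); split; [|rewrite ltr_norml]; lra.
Qed.

Section Box.
Context (R : realType) (d : nat).
Implicit Types (lo hi : 'I_d -> R) (x y z : 'rV[R]_d) (r : 'rV[R]_d -> R).

Definition box lo hi : set 'rV[R]_d := [set x | forall i, lo i <= x 0 i <= hi i].

Lemma open_box_interior lo hi x :
  (forall i, lo i < x 0 i < hi i) -> (box lo hi)° x.
Proof.
move=> xin.
have : nbhs x [set y : 'rV[R]_d | forall i, lo i < y 0 i < hi i].
  have /(_ (nbhs x) _) allI := @filter_forall _ _ (fun i => [set y : 'rV[R]_d | lo i < y 0 i < hi i]).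
  apply: allI => i.
  apply: (@coord_continuous R 1 d 0 i x [set t | lo i < t < hi i]).
  have /near_in_itvoo : x 0 i \in `]lo i, hi i[ by rewrite in_itv /=.
  by apply: filterS => t; rewrite in_itv.
by apply: filterS => y yin i; have /andP[/ltW -> /ltW ->] := yin i.
Qed.

Section Lipschitz.
Context (lo hi : 'I_d -> R) (r : 'rV[R]_d -> R) (M : R).
Context (M_ge0 : 0 <= M).
Context (r_der : forall (i : 'I_d) x, (box lo hi)° x ->
  derivable r x (delta_mx 0 i) /\ `|'D_(delta_mx 0 i) r x| <= M).

Lemma axis_lipschitz (i : 'I_d) z t :
  (forall j, lo j < z 0 j < hi j) ->
  (forall j, lo j < (z + t *: delta_mx 0 i) 0 j < hi j) ->
  `|r (z + t *: delta_mx 0 i) - r z| <= M * `|t|.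
Proof.
wlog t_ge0 : z t / 0 <= t => [H|] zin ztin.
  have [/H|t_lt0] := leP 0 t; first exact.
  rewrite -normrN opprB -[X in r X - _](addrK (t *: delta_mx 0 i)) -scaleNr.
  rewrite -(normrN t); apply: H => //; first by rewrite oppr_ge0 ltW.
  by rewrite scaleNr addrK.
pose g (s : R) := r (z + s *: delta_mx 0 i).
have seg s : s \in `[0, t] -> (box lo hi)° (z + s *: delta_mx 0 i).
  rewrite in_itv /= => /andP[s0 st]; apply: open_box_interior => j.
  have := zin j; have := ztin j; rewrite !mxE eqxx /=.
  by case: eqP => _ /=; rewrite ?mulr1 ?mulr0; lra.
have g_der s : s \in `[0, t] ->
    is_derive s 1 g ('D_(delta_mx 0 i) r (z + s *: delta_mx 0 i)).
  move=> /seg /(r_der i)[+ _].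
  have E : (fun h : R => h^-1 *: (g (h *: 1 + s) - g s)) =
    (fun h => h^-1 *: (r (h *: delta_mx 0 i + (z + s *: delta_mx 0 i))
                        - r (z + s *: delta_mx 0 i))).
    apply/funext => h; congr (_ *: (r _ - _)).
    by rewrite scalerDl -scalerA scale1r addrCA.
  by move=> dr; split; [rewrite /derivable|rewrite /derive]; rewrite /= E.
have g_cont : {within `[0, t], continuous g}.
  apply: derivable_within_continuous => s /g_der gs.
  exact: ex_derive.
have [s sin] := MVT_segment t_ge0 (fun s sin => g_der s (subset_itv_oo_cc sin)) g_cont.
rewrite {1 2}/g scale0r addr0 subr0 => ->; rewrite normrM ler_wpM2r//.
by have [_] := r_der i (seg _ sin).
Qed.

(** Only partial derivatives are given, not differentiability, so x and y are
    joined by moving one coordinate at a time; the increments telescope. *)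
Lemma open_box_lipschitz x y :
  (forall j, lo j < x 0 j < hi j) -> (forall j, lo j < y 0 j < hi j) ->
  `|r x - r y| <= M * \sum_i `|x 0 i - y 0 i|.
Proof.
move=> xin yin.
pose z k : 'rV[R]_d := \row_i (if (i < k)%N then y 0 i else x 0 i).
have zin k j : lo j < z k 0 j < hi j by rewrite mxE; case: ifP.
have -> : r x = r (z 0%N) by congr r; apply/rowP => i; rewrite mxE.
have -> : r y = r (z d) by congr r; apply/rowP => i; rewrite mxE ltn_ord.
rewrite distrC -(telescope_sumr (r \o z)) // big_mkord mulr_sumr.
apply: le_trans (ler_norm_sum _ _ _) (ler_sum _ _) => i _ /=.
have zS : z i.+1 = z i + (y 0 i - x 0 i) *: delta_mx 0 i.
  apply/rowP => j; rewrite !mxE eqxx /= ltnS leq_eqVlt.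
  case: (j =P i) => [->|/eqP ji]; first by rewrite eqxx ltnn /= mulr1 addrC subrK.
  by rewrite -(inj_eq val_inj) /= in ji; rewrite (negPf ji) mulr0 addr0.
by rewrite zS distrC (distrC (x 0 i)) distrC axis_lipschitz // -zS.
Qed.

(** The derivatives are only controlled in the interior, whereas collocation
    points may sit on the faces.  By continuity, x and y can be replaced with
    points of the open box at an arbitrarily small cost. *)
Lemma box_lipschitz x y :
  (forall i, lo i < hi i) -> {within box lo hi, continuous r} ->
  box lo hi x -> box lo hi y ->
  `|r x - r y| <= M * \sum_i `|x 0 i - y 0 i|.
Proof.
move=> lohi /subspace_continuousP r_cont xin yin.
have approx z e : box lo hi z -> 0 < e -> exists z',
    [/\ forall i, lo i < z' 0 i < hi i, `|r z - r z'| < e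
      & forall i, `|z 0 i - z' 0 i| < e].
  move=> zin e0; have /cvgrPdist_lt /(_ e e0) := r_cont z zin.
  rewrite near_withinE => /nbhs_ballP[e' /= e'0 ze'].
  have ee'0 : 0 < Num.min e e' by rewrite lt_min e0.
  have /choice[s sP] i := itv_approx (lohi i) (zin i) ee'0.
  exists (\row_i s i); split=> [i||i].
  - by rewrite mxE; have [] := sP i.
  - apply: ze'.
      split=> // k i; rewrite ord1 /ball /= mxE.
      by have [_] := sP i; rewrite lt_min => /andP[].
    by move=> i; rewrite mxE; have [/andP[/ltW -> /ltW ->]] := sP i.
  - by rewrite mxE; have [_] := sP i; rewrite lt_min => /andP[].
apply/ler_addgt0Pr => e e0.
(* Twice e' pays for the change of values, M * 2 * d * e' for the move. *)
pose e' := e / (2 + M * (2 * d%:R)).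
have den0 : 0 < 2 + M * (2 * d%:R) :> R by rewrite ltr_wpDr // !mulr_ge0.
have e'0 : 0 < e' by rewrite divr_gt0.
have [x' [x'in rx' xx']] := approx x e' xin e'0.
have [y' [y'in ry' yy']] := approx y e' yin e'0.
have sum_le : \sum_i `|x' 0 i - y' 0 i| <=
    \sum_i `|x 0 i - y 0 i| + (2 * d%:R) * e'.
  have -> : 2 * d%:R * e' = \sum_(i < d) (2 * e').
    by rewrite sumr_const card_ord -[RHS]mulr_natr mulrAC.
  rewrite -big_split /=; apply: ler_sum => i _.
  have := xx' i; have := yy' i; rewrite (distrC (y 0 i)).
  have -> : x' 0 i - y' 0 i = (x 0 i - y 0 i) - (x 0 i - x' 0 i) - (y' 0 i - y 0 i) by ring.
  move=> ? ?; apply: le_trans (ler_normB _ _) _; apply: le_trans (lerD (ler_normB _ _) (lexx _)) _; lra.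
have -> : r x - r y = (r x - r x') + (r x' - r y') - (r y - r y') by ring.
have L := open_box_lipschitz x'in y'in.
have ML := ler_wpM2l M_ge0 sum_le.
have eE : e = 2 * e' + M * (2 * d%:R * e').
  rewrite -[LHS](divfK (lt0r_neq0 den0)) -/e'; ring.
apply: le_trans (ler_normB _ _) _; apply: le_trans (lerD (ler_normD _ _) (lexx _)) _.
rewrite mulrDr in ML; rewrite {1}eE; lra.
Qed.

End Lipschitz.

End Box.

(** * Sampling a Lipschitz function *)

Lemma nat_dist_lt1 (a b : nat) : `|a%:Z - b%:Z| < 1 -> a = b.
Proof. lia. Qed.

(** The heart of the argument: a nonnegative Lipschitz function that is large
    somewhere is large along a whole segment, and a dense enough sampling meets
    that segment too often for a sum bounded by C.  The threshold h0 is chosen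
    before the function and the sampling points, so that it serves all indices
    of a family at once. *)
Lemma sampled_le (R : realType) (d : nat) (lo hi : 'I_d -> R) (i0 : 'I_d) (M C e : R) :
  (forall i, lo i < hi i) -> 0 <= M -> 0 < e ->
  exists2 h0 : R, 0 < h0 &
  forall (r : 'rV[R]_d -> R) m (th : 'I_m -> 'rV[R]_d) (h : R),
    (forall x, 0 <= r x) ->
    (forall x y, box lo hi x -> box lo hi y ->
       `|r x - r y| <= M * \sum_i `|x 0 i - y 0 i|) ->
    (forall k, box lo hi (th k)) ->
    (forall x, box lo hi x -> exists k, forall i, `|x 0 i - th k 0 i| <= h) ->
    \sum_k r (th k) <= C -> h < h0 ->
  forall x, box lo hi x -> r x <= e.
Proof.
move=> lohi M0 e0.
(* M * d * D <= e / 2 keeps r above e / 2 near x; the second term of the minimum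
   lets a segment of length D fit on one side of any point of the box. *)
pose D := Num.min (e / (2 * (M * d%:R + 1))) ((hi i0 - lo i0) / 2).
have Md0 : 0 <= M * d%:R by rewrite mulr_ge0.
have D0 : 0 < D.
  rewrite lt_min !divr_gt0 ?subr_gt0 ?mulr_gt0 //; lra.
have MD : M * (d%:R * D) <= e / 2.
  have H : D <= e / (2 * (M * d%:R + 1)) by rewrite ge_min lexx.
  move: H; rewrite ler_pdivlMr; last lra.
  by move: (ltW D0); nra.
have Dw : D <= (hi i0 - lo i0) / 2 by rewrite ge_min lexx orbT.
pose K := (Num.bound (`|C| * 2 / e)).+1.
have K0 : 0 < K%:R :> R by rewrite ltr0n.
have KC : C < K%:R * (e / 2).
  have : `|C| * 2 / e < K%:R.
    apply: lt_le_trans (archi_boundP _) _; last by rewrite ler_nat.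
    by rewrite divr_ge0 ?mulr_ge0 // ltW.
  rewrite ltr_pdivrMr // => H; apply: le_lt_trans (ler_norm C) _; lra.
pose s := D / (2 * K%:R).
have s0 : 0 < s by rewrite divr_gt0 ?mulr_gt0.
have sK : s * K%:R = D / 2 by rewrite /s; field; rewrite lt0r_neq0.
have sD : s <= D / 2.
  by rewrite -sK ler_peMr ?ler1n // ltW.
exists (s / 2); first by rewrite divr_gt0.
move=> r m th h r0 r_lip th_in th_near th_sum hs x xin.
rewrite leNgt; apply/negP => rx.
(* The sign sg directs the segment towards the farther face. *)
have [sg [sg1 sgin]] : exists sg : R, `|sg| = 1 /\
    forall t, 0 <= t <= D -> lo i0 <= x 0 i0 + sg * t <= hi i0.
  have := xin i0; have [xm xi|xm xi] := leP (x 0 i0) ((lo i0 + hi i0) / 2).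
    by exists 1; split=> [|t]; rewrite ?normr1 // => ?; lra.
  by exists (-1); split=> [|t]; rewrite ?normrN1 // => ?; lra.
pose q (j : 'I_K) : 'rV[R]_d := x + (sg * (j%:R * s)) *: delta_mx 0 i0.
have jD (j : 'I_K) : 0 <= j%:R * s <= D / 2.
  by rewrite mulr_ge0 ?ler0n ?(ltW s0) //= -sK [leLHS]mulrC ler_pM2l // ler_nat ltnW.
have qin j : box lo hi (q j).
  move=> i; rewrite !mxE eqxx /=; case: eqP => [->|_].
    by rewrite mulr1; apply: sgin; have := jD j; lra.
  by rewrite mulr0 addr0; exact: xin.
have /choice[k kP] j := th_near _ (qin j).
(* Two q's sharing a collocation point would be within 2h < s of each other. *)
have k_inj : injective k.
  move=> j j' jj'; apply: contrapT => /eqP neq.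
  have Hj := kP j i0; have Hj' := kP j' i0; rewrite -jj' in Hj'.
  have : `|q j 0 i0 - q j' 0 i0| < s.
    have -> : q j 0 i0 - q j' 0 i0 =
      (q j 0 i0 - th (k j) 0 i0) - (q j' 0 i0 - th (k j) 0 i0) by ring.
    by apply: le_lt_trans (ler_normB _ _) _; lra.
  rewrite !mxE !eqxx /= !mulr1.
  have -> : x 0 i0 + sg * (j%:R * s) - (x 0 i0 + sg * (j'%:R * s)) =
    sg * ((j%:R - j'%:R) * s) by ring.
  rewrite normrM sg1 mul1r normrM (gtr0_norm s0).
  rewrite -[X in _ < X]mul1r ltr_pM2r // => H.
  have : `|(j%:Z - j'%:Z)%:~R : R| < 1%:~R by rewrite rmorphB.
  rewrite -intr_norm ltr_int => /nat_dist_lt1 jj.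
  by move/negP: neq; apply; rewrite -(inj_eq val_inj) /= jj.
have big j : e / 2 <= r (th (k j)).
  have := r_lip _ _ xin (th_in (k j)).
  suff : M * \sum_i `|x 0 i - th (k j) 0 i| <= e / 2.
    by move=> H1 H2; have := ler_norm (r x - r (th (k j))); lra.
  apply: le_trans MD; rewrite ler_wpM2l //.
  have -> : d%:R * D = \sum_(i < d) D by rewrite sumr_const card_ord mulr_natl.
  apply: ler_sum => i _.
  have -> : x 0 i - th (k j) 0 i = (q j 0 i - th (k j) 0 i) + (x 0 i - q j 0 i) by ring.
  apply: le_trans (ler_normD _ _) _; have := kP j i.
  suff : `|x 0 i - q j 0 i| <= D / 2 by lra.
  rewrite !mxE eqxx /= opprD addNKr normrN normrM.
  have -> : `|sg * (j%:R * s)| = j%:R * s.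
    by rewrite normrM sg1 mul1r ger0_norm //; have /andP[] := jD j.
  have := jD j; case: eqP => _; rewrite ?normr1 ?normr0; lra.
have : K%:R * (e / 2) <= \sum_k r (th k).
  have -> : K%:R * (e / 2) = \sum_(j < K) (e / 2).
    by rewrite sumr_const card_ord mulr_natl.
  apply: le_trans (_ : \sum_(l in k @: 'I_K) r (th l) <= _).
    rewrite big_imset /=; last by move=> ? ? _ _; exact: k_inj.
    rewrite [leRHS](eq_bigl xpredT) //.
    by apply: ler_sum => j _.
  rewrite [leRHS](bigID (mem (k @: 'I_K))) /= lerDl.
  by apply: sumr_ge0.
by move=> H; have := le_trans H th_sum; rewrite leNgt KC.
Qed.

(** * Knot grids *)

Section Grid.
Context (R : realType) (d : nat) (N : nurbs_space R d).

Lemma chain_cover (u : nat -> R) n t :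
  (0 < n)%N -> u 0 <= t <= u n -> exists j : 'I_n, u j <= t <= u j.+1.
Proof.
elim: n => // n IH _ /andP[t0 tn].
have [tu|ut] := leP t (u n); last by exists ord_max; rewrite ltW.
have [n0|n0] := posnP n; first by exists ord0; rewrite t0 n0 in tn *.
have [j jt] := IH n0 (introT andP (conj t0 tu)).
by exists (widen_ord (leqnSn n) j).
Qed.

Lemma brk_ends i : brk N i 0 < brk N i (nel N i).
Proof.
have H n : (n < nel N i)%N -> brk N i 0 < brk N i n.+1.
  elim: n => [|n IH] nn; first exact: brk_lt.
  by apply: lt_trans (IH (ltnW nn)) (brk_lt nn).
by have := nel_gt0 N i; case: (nel N i) H => // n H _; exact: H.
Qed.

Lemma cell_cover x : nurbs_domain N x -> exists q : cell_idx N, cell q x.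
Proof.
move=> xin.
have [q qP] := fin_all_exists (fun i => chain_cover (nel_gt0 N i) (xin i)).
by exists [ffun i => q i] => i; rewrite ffunE.
Qed.

(** The grid size is measured by Euclidean diameters, each of which dominates every
    coordinate difference.  Boundedness of the cell matters: the supremum of an
    unbounded set would be 0. *)
Lemma cell_coord_le_grid_size (q : cell_idx N) x y i :
  cell q x -> cell q y -> `|x 0 i - y 0 i| <= grid_size N.
Proof.
move=> xq yq.
apply: le_trans (_ : enorm (x - y) <= _).
  rewrite -sqrtr_sqr /enorm ler_wsqrtr // (bigD1 i) //= !mxE lerDl.
  by apply: sumr_ge0 => j _; exact: sqr_ge0.
apply: le_trans (_ : ediam (cell q) <= _); last first.
  by rewrite /grid_size; apply: le_bigmax.
apply: sup_ubound; last by exists (x, y).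
pose b := Num.sqrt (\sum_j (brk N j (q j).+1 - brk N j (q j)) ^+ 2).
exists b => _ [[v w] [/= vq wq] <-]; apply: ler_wsqrtr; apply: ler_sum => j _.
have := vq j; have := wq j; rewrite !mxE => /andP[w1 w2] /andP[v1 v2].
by rewrite -real_normK ?num_real // ler_sqr ?nnegrE //; rewrite ?ler_norml; lra.
Qed.

End Grid.

(** * Bounding L2 norms by suprema *)

Section L2.
Context (R : realType).

Lemma poweR2 (x : \bar R) : (0 <= x -> x `^ 2 = x ^+ 2)%E.
Proof.
case: x => [x| |] // x0; last by rewrite poweRyr // expe2 mulyy.
by rewrite poweR_EFin powR_mulrn // EFin_expe.
Qed.

(** The integral of a nonnegative function is a supremum over the simple functions
    below it, hence monotone without any measurability.  The L2 bounds that
    follow therefore apply to residuals of arbitrary sign pattern. *)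
Lemma ge0_le_integral_nonmeas (dd : measure_display) (U : measurableType dd)
    (mu : {measure set U -> \bar R}) (f g : U -> \bar R) :
  (forall x, 0 <= f x)%E -> (forall x, f x <= g x)%E ->
  (\int[mu]_x f x <= \int[mu]_x g x)%E.
Proof.
move=> f0 fg; rewrite !ge0_integralTE // => [|x]; last exact: le_trans (fg x).
by apply: ereal_sup_le => _ [h hf <-]; exists h => // x; exact: le_trans (fg x).
Qed.

Lemma Lnorm2_sqr_le (dd : measure_display) (U : measurableType dd)
    (mu : {measure set U -> \bar R}) (A : set U) (g : U -> R) (e : R) : measurable A -> 0 <= e ->
  (forall x, g x ^+ 2 <= e * \1_A x) ->
  (('N[mu]_2%:E[(fun x => (g x)%:E)]) ^+ 2 <= e%:E * mu A)%E.
Proof.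
move=> mA e0 gA.
rewrite -poweR2 ?Lnorm_ge0 // powR_Lnorm // -integral_cst // [leRHS]integral_mkcond.
apply: ge0_le_integral_nonmeas => [x|x]; first exact: poweR_ge0.
rewrite poweR2 // -EFin_expe real_normK ?num_real // patchE.
by have := gA x; rewrite indicE; case: ifP => _; rewrite ?mulr1 ?mulr0 lee_fin.
Qed.

Lemma lebesgue_measure_cc (a b : R) : a <= b ->
  lebesgue_measure (`[a, b]%classic : set R) = (b - a)%:E.
Proof.
move=> ab; rewrite lebesgue_measure_itv /= lte_fin.
by move: ab; rewrite le_eqVlt => /orP[/eqP ->|->]; rewrite ?ltxx ?subrr.
Qed.

Lemma product_measure_fin (dd1 dd2 : measure_display) (U1 : measurableType dd1)
    (U2 : measurableType dd2) (mu1 : {measure set U1 -> \bar R})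
    (mu2 : {sigma_finite_measure set U2 -> \bar R}) (A1 : set U1) (A2 : set U2)
    (v1 v2 : R) :
  measurable A1 -> measurable A2 -> mu1 A1 = v1%:E -> mu2 A2 = v2%:E ->
  (mu1 \x mu2)%E (A1 `*` A2) = (v1 * v2)%:E.
Proof. by move=> mA1 mA2 E1 E2; rewrite product_measure1E // E1 E2. Qed.

Lemma L2norm_sqr_le d (lo hi : 'I_d -> R) (u : 'rV[R]_d -> R) (e : R) :
  (1 <= d <= 3)%N -> (forall i, lo i < hi i) -> 0 <= e ->
  (forall x, box lo hi x -> u x ^+ 2 <= e) ->
  (L2norm (box lo hi) u ^+ 2 <= (e * \prod_i (hi i - lo i))%:E)%E.
Proof.
move=> d13 lohi e0 ue.
have ind_le (s : seq R) (b : bool) : (box lo hi (vec d s) -> b) ->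
    (\1_(box lo hi) (vec d s) * u (vec d s)) ^+ 2 <= e * b%:R.
  move=> H; rewrite indicE; case: (boolP (_ \in _)) => [/set_mem sin|_].
    by rewrite H // mul1r mulr1 ue.
  by rewrite mul0r expr0n /= mulr_ge0.
pose I i := `[lo i, hi i]%classic : set R.
have mI i : measurable (I i) by exact: measurable_itv.
have muI i : lebesgue_measure (I i) = (hi i - lo i)%:E.
  by apply: lebesgue_measure_cc; exact: ltW.
(* For each of the three dimensions, the box is read as a product of intervals. *)
case: d lo hi u d13 lohi ue ind_le @I mI muI => [|[|[|[|d]]]] // lo hi u _ lohi ue ind_le I mI muI.
- have := @Lnorm2_sqr_le _ _ lebesgue_measure (I 0)
    (fun t => \1_(box lo hi) (vec 1 [:: t]) * u (vec 1 [:: t])) e (mI 0) e0.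
  rewrite [X in (_ <= _ * X)%E](muI 0) big_ord1 EFinM; apply => t.
  rewrite [X in e * X]indicE; apply: ind_le => /(_ 0); rewrite mxE /= => tin.
  by apply/mem_set; rewrite /I /= in_itv.
- have I01E : (lebesgue_measure \x lebesgue_measure)%E (I 0 `*` I 1) =
      ((hi 0 - lo 0) * (hi 1 - lo 1))%:E.
    by apply: product_measure_fin; [exact: mI | exact: mI | exact: muI | exact: muI].
  have := @Lnorm2_sqr_le _ _ (lebesgue_measure \x lebesgue_measure)%E (I 0 `*` I 1)
    (fun t => let s := vec 2 [:: t.1; t.2] in \1_(box lo hi) s * u s) e
    (measurableX (mI 0) (mI 1)) e0.
  rewrite [X in (_ <= _ * X)%E]I01E.
  rewrite -EFinM !big_ord_recl big_ord0 mulr1.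
  rewrite (_ : lift ord0 ord0 = 1); last exact/val_inj.
  apply => t; rewrite [X in e * X]indicE; apply: ind_le => tin; apply/mem_set.
  by have := tin 0; have := tin 1; rewrite !mxE /= => ? ?; split; rewrite /I /= in_itv.
- pose i2 : 'I_3 := lift ord0 (lift ord0 ord0).
  have I01E : (lebesgue_measure \x lebesgue_measure)%E (I 0 `*` I 1) =
      ((hi 0 - lo 0) * (hi 1 - lo 1))%:E.
    by apply: product_measure_fin; [exact: mI | exact: mI | exact: muI | exact: muI].
  have I012E : ((lebesgue_measure \x lebesgue_measure) \x lebesgue_measure)%E
      ((I 0 `*` I 1) `*` I i2) =
      ((hi 0 - lo 0) * (hi 1 - lo 1) * (hi i2 - lo i2))%:E.
    by apply: product_measure_fin;
      [exact: measurableX (mI 0) (mI 1) | exact: mI | exact: I01E | exact: muI].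
  have := @Lnorm2_sqr_le _ _
    ((lebesgue_measure \x lebesgue_measure) \x lebesgue_measure)%E
    ((I 0 `*` I 1) `*` I i2)
    (fun t => let s := vec 3 [:: t.1.1; t.1.2; t.2] in \1_(box lo hi) s * u s) e
    (measurableX (measurableX (mI 0) (mI 1)) (mI i2)) e0.
  rewrite [X in (_ <= _ * X)%E]I012E.
  rewrite -EFinM !big_ord_recl big_ord0 mulr1 -[in X in X -> _]mulrA.
  rewrite (_ : lift ord0 (ord0 : 'I_2) = 1); last exact/val_inj.
  apply => t; rewrite [X in e * X]indicE; apply: ind_le => tin; apply/mem_set.
  by have := tin 0; have := tin 1; have := tin i2; rewrite !mxE /= => ? ? ?; do !split; rewrite /I /= in_itv.
Qed.

Lemma nonneg_cvge0 (v : nat -> \bar R) :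
  (forall n, 0 <= v n)%E ->
  (forall e : R, 0 < e -> \forall n \near \oo, (v n <= e%:E)%E) ->
  v n @[n --> \oo] --> 0%E.
Proof.
move=> v0 ve; apply/fine_cvgP; split.
  have := ve 1 ltr01; apply: filterS => n vn.
  by rewrite ge0_fin_numE //; exact: le_lt_trans vn (ltry _).
apply/cvgr0Pnorm_le => e e0; have := ve e e0; apply: filterS => n vn /=.
rewrite ger0_norm ?fine_ge0 // -lee_fin fineK //.
by rewrite ge0_fin_numE //; exact: le_lt_trans vn (ltry _).
Qed.

End L2.

(** * Consistency *)

Theorem theorem3 (R : realType) (d : nat) (hd : (1 <= d <= 3)%N)
    (Omega0 Omega : set 'rV[R]_d) (F Finv : 'rV[R]_d -> 'rV[R]_d)
    (hF : nurbs_param Omega0 Omega F Finv)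
    (d1 d2 : nat) (hd1 : (1 <= d1)%N) (hd2 : (d1 < d2)%N)
    (c a : mindex d d1 -> 'rV[R]_d -> R)
    (hc : has_order Omega c) (ha : param_expr Omega0 Omega F c a)
    (G : ('rV[R]_d -> R) -> 'rV[R]_d -> R)
    (f g T : 'rV[R]_d -> R)
    (hT : Ck Omega d2 T)
    (hDT : forall x, Omega° x -> diffop Omega c T x = f x)
    (hGT : forall x, bdry Omega x -> G T x = g x)
    (p : nat -> discretization R d)
    (X : forall n, 'cV[R]_(nunk (trial_space (p n)))) :
  let DD := diffop Omega0 a in
  let GG := fun phi eta => G (phi \o Finv) (F eta) in
  let Tr n := nurbs_fun (X n) in
  let Rh n := sqres DD (T \o F) (Tr n) in
  forall
    (hX : forall n, igal_solution DD GG (f \o F) (g \o F) Omega0 (X n))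
    (hyp1 : forall n (q : cell_idx (trial_space (p n))),
       exists k, cell q (@colloc R d (p n) k))
    (hyp2 : forall n i, order_in_lt Omega0 a i (deg (trial_space (p n)) i))
    (hyp3 : exists C : R, forall n, fit_error (p n) (Rh n) <= C)
    (hyp4 : C1_family Omega0 Rh),
  grid_size (trial_space (p n)) @[n --> \oo] --> (0 : R) ->
  (L2norm Omega0 (fun eta => (DD (T \o F) eta - DD (Tr n) eta)%R) ^+ 2)%E
    @[n --> \oo] --> 0%E.
Proof.
move=> DD GG Tr Rh hX hyp1 hyp2 [C hC] [hC1 [M hM]] hgrid.
(* All trial spaces live on the same box; its bounds are read off the first. *)
pose lo i := brk (trial_space (p 0)) i 0.
pose hi i := brk (trial_space (p 0)) i (nel (trial_space (p 0)) i).
have domE n : nurbs_domain (trial_space (p n)) = box lo hi.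
  have [[E _ _ _] _] := hX n; have [[E0 _ _ _] _] := hX 0%N.
  by rewrite E -E0.
have OmegaE : Omega0 = box lo hi by have [[<- _ _ _] _] := hX 0%N.
have lohi i : lo i < hi i by exact: brk_ends.
have M0 : 0 <= Num.max M 0 by rewrite le_max lexx orbT.
rewrite OmegaE in hC1 hM *.
have Rh_lip n x y : box lo hi x -> box lo hi y ->
    `|Rh n x - Rh n y| <= Num.max M 0 * \sum_i `|x 0 i - y 0 i|.
  have [cont der] := hC1 n; apply: box_lipschitz => // i z zin; split.
    by have [gi [/(_ z zin) dz _]] := der i; exact: ex_derive.
  by rewrite le_max hM.
have th_in n k : box lo hi (@colloc R d (p n) k).
  have [[_ hin hbd _] _] := hX n.
  rewrite /colloc; case: fintype.split => j; rewrite -OmegaE.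
    by apply: interior_subset; exact: hin.
  by have [] := hbd j.
have near_pt n x : box lo hi x ->
    exists k, forall i, `|x 0 i - @colloc R d (p n) k 0 i| <= grid_size (trial_space (p n)).
  rewrite -(domE n) => /cell_cover[q xq]; have [k kq] := hyp1 n q.
  by exists k => i; exact: cell_coord_le_grid_size xq kq.
have d_gt0 : (0 < d)%N by case/andP: hd.
have V0 : 0 < \prod_i (hi i - lo i) by apply: prodr_gt0 => i _; rewrite subr_gt0.
apply: nonneg_cvge0 => [n|e e0]; first exact: sqre_ge0.
have e'0 : 0 < e / \prod_i (hi i - lo i) by rewrite divr_gt0.
have [h0 h0_gt0 small] := sampled_le (Ordinal d_gt0) C lohi M0 e'0.
move/cvgr_lt : hgrid => /(_ _ h0_gt0); apply: filterS => n hn.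
have -> : e = e / (\prod_i (hi i - lo i)) * \prod_i (hi i - lo i).
  by rewrite divfK // lt0r_neq0.
apply: L2norm_sqr_le => //; first exact: ltW.
apply: (small (Rh n) _ (@colloc R d (p n)) _ _ (Rh_lip n) (th_in n) (near_pt n)
  (hC n) hn) => x.
exact: sqr_ge0.
Qed.
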